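(* Let $H$ be a simple hypergraph with $e$-index $k$ and let $P_{\mathbf{U}(H)}(x)=x^{k}+c_1x^{k-1}+\dots+c_k$ be the characteristic polynomial of its unified matrix $\mathbf{U}(H)$. Then for $t\in\{1,2,\dots,k\}$, $$c_t=\sum(-1)^{c(H')+e(H')}\,2^{c(H')},$$ where the summation is over all elementary $t$-subhypergraphs $(H',\mathcal{C}(H'),\mathcal{E}(H'))_t$ of $H$, and $c(H')=|\mathcal{C}(H')|$, $e(H')=|\mathcal{E}(H')|$.
   Context: A hypergraph $H$ consists of a finite non-empty vertex set $V(H)$ and a multiset $E(H)$ of non-empty subsets of $V(H)$, called edges. It is simple if it has neither loops (edges of cardinality one) nor multiple edges. A subhypergraph of $H$ is a hypergraph $H'$ with $V(H')\subseteq V(H)$ and $E(H')\subseteq E(H)$. A 2-partition of a set $e$ is an unordered pair $\{S,S'\}$ of non-empty disjoint sets with $S\cup S'=e$; $S$ and $S'$ are called parts of $e$. $I(H)$ is the set of all parts of all edges of $H$ together with all singleton subsets of $V(H)$, and $k=|I(H)|$ is the $e$-index of $H$. For simple $H$, the unified matrix $\mathbf{U}(H)$ is the $k\times k$ matrix with rows and columns indexed by $I(H)$ whose $(S,S')$ entry is $1$ if $\{S,S'\}$ is a 2-partition of an edge of $H$, and $0$ otherwise. An exact walk in $H$ is a sequence $S_0,e_1,S_1,e_2,S_2,\dots,e_n,S_n$ such that $\{S_{i-1},S_i\}$ is a 2-partition of the edge $e_i$ of $H$ for $i=1,\dots,n$. The sets $S_0,\dots,S_n$ are its parts, $S_0$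 is its initial part, $S_n$ is its terminal part, and the other parts are internal; its cover is the set of all its parts, and its length is $n$. An exact cycle is an exact walk with at least three distinct edges whose initial and terminal parts are the same and whose internal parts are all distinct; $l(C)$ denotes the length of an exact cycle $C$. Two exact walks (in particular, two exact cycles) are disjoint if their sets of parts are disjoint. For $q\in\{2,3,\dots,k\}$, a triplet $(H',\mathcal{C}(H'),\mathcal{E}(H'))_q$ is an elementary $q$-subhypergraph of $H$ if: (i) $H'$ is a subhypergraph of $H$; (ii) $\mathcal{C}(H')$ is a set which is either empty or consists of some disjoint exact cycles $C_1,\dots,C_r$ in $H'$, and $\mathcal{E}(H')$ is a set which is either empty or consists of 2-partitions of some edges $e_1,\dots,e_s$ in $H'$, such that $\sum_{C\in\mathcal{C}(H')}l(C)+2|\mathcal{E}(H')|=q$; (iii) letting $\mathcal{C}^*(H')$ denote the union of the covers of the disjoint exact cycles in $\mathcal{C}(H')$, if $S\in\mathcal{C}^*(H')\cup\left(\bigcup_{T\in\mathcal{E}(H')}T\right)$, then $S$ belongs to either $\mathcal{C}^*(H')$ or at most one set in $\mathcal{E}(H')$. For $t=1$ there are no elementary $t$-subhypergraphs, and the empty sum is $0$ (that is, $c_1=0$).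
   Formalization: The sum counts each pair (𝒞(H'), ℰ(H')) once, whatever the subhypergraph H' containing it, and exact cycles are taken up to starting part and direction; summing over all triplets fails, e.g. for one edge {a,b} plus an isolated vertex. *)

(* Defs.v *)
From HB Require Import structures.
From mathcomp Require Import all_boot all_order all_algebra.
From mathcomp Require Import zify.

Set Implicit Arguments.
Unset Strict Implicit.
Unset Printing Implicit Defensive.

Import GRing.Theory.

Section CyclicSequences.
Variable V : finType.

Lemma pairmap_prev (rT : Type) (f : V -> V -> rT) (x0 : V) (s : seq V) :
  uniq s -> last x0 s = x0 ->
  pairmap f x0 s = [seq f (prev s y) y | y <- s].
Proof.
case: s => [|y s] // us lx; have /andP[ys us'] := us.
apply: (@eq_from_nth _ (f y y)); rewrite size_pairmap ?size_map // => i is_.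
rewrite (nth_pairmap y) // (nth_map y) // prev_nth mem_nth //.
congr (f _ _); case: i is_ => [|i] is_; last first.
  by rewrite [nth y (y :: s) i.+1]/= index_uniq.
by rewrite [nth y _ _]/= (memNindex ys) nth_last /= -lx.
Qed.

(* The unordered pairs of cyclically consecutive entries of s.               *)
Definition edgeset (s : seq V) : {set {set V}} :=
  [set P in [seq [set x; next s x] | x <- s]].

Lemma pairmap_edgeset (x0 : V) (s : seq V) :
  uniq s -> last x0 s = x0 ->
  [set P in pairmap (fun x y => [set x; y]) x0 s] = edgeset s.
Proof.
move=> us ls; rewrite pairmap_prev //; apply/setP=> P; rewrite !inE.
apply/mapP/mapP => -[x xs ->].
  by exists (prev s x); rewrite ?mem_prev // next_prev.
by exists (next s x); rewrite ?mem_next // prev_next.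
Qed.

Lemma edgeset_rot n s : uniq s -> edgeset (rot n s) = edgeset s.
Proof.
move=> us; apply/setP=> P; rewrite !inE.
apply/mapP/mapP => -[x xs ->]; exists x; rewrite ?mem_rot ?next_rot //.
by rewrite -(mem_rot n).
Qed.

Lemma edgeset_rev s : uniq s -> edgeset (rev s) = edgeset s.
Proof.
move=> us; apply/setP=> P; rewrite !inE.
apply/mapP/mapP => -[x xs ->]; rewrite ?mem_rev in xs.
  by exists (prev s x); rewrite ?mem_prev // next_prev // next_rev // setUC.
exists (next s x); first by rewrite mem_rev mem_next.
by rewrite next_rev // prev_next // setUC.
Qed.

Lemma next_next (s : seq V) x : uniq s -> 2 < size s -> x \in s ->
  [/\ next s x != x & next s (next s x) != x].
Proof.
move=> us n3 /rot_to[i s' E].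
have ur : uniq (rot i s) by rewrite rot_uniq.
rewrite -!(next_rot i us); move: n3 ur; rewrite -(size_rot i) E.
case: s' {E} => [|a [|b r]] //= _; rewrite !inE !negb_or.
case/and3P=> /and3P[xa xb xr] /andP[ab ar] _.
by rewrite eqxx [a == x]eq_sym (negbTE xa) eqxx [b == x]eq_sym.
Qed.

Lemma edgeset_next s x y : uniq s -> 2 < size s -> [set x; y] \in edgeset s ->
  x \in s /\ (y = next s x \/ y = prev s x).
Proof.
move=> us n3; rewrite inE => /mapP[z zs /setP E].
have [nz _] := next_next us n3 zs.
have := E x; have := E z; have := E (next s z).
rewrite !inE !eqxx !orbT /= => nzE zE /esym /orP[] /eqP xE; subst x.
  by move: nzE; rewrite (negbTE nz) /= => /eqP <-; split=> //; left.
move: zE; rewrite eq_sym (negbTE nz) /= => /eqP <-.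
by rewrite mem_next prev_next //; split=> //; right.
Qed.

Lemma edgeset_inj1 s t x0 : uniq s -> uniq t -> 2 < size s -> 2 < size t ->
  edgeset s = edgeset t -> x0 \in s -> next t x0 = next s x0 ->
  exists n, t = rot n s.
Proof.
move=> us ut s3 t3 E x0s nx0.
have inE' x : x \in s -> x \in t.
  move=> xs; have : [set x; next s x] \in edgeset s.
    by rewrite inE; apply/mapP; exists x.
  by rewrite E => /edgeset_next -[].
have inE2 x : x \in t -> x \in s.
  move=> xs; have : [set x; next t x] \in edgeset t.
    by rewrite inE; apply/mapP; exists x.
  by rewrite -E => /edgeset_next -[].
have sz : size s = size t.
  apply/eqP; rewrite -uniq_size_uniq // => x.
  by apply/idP/idP; auto.
have step x : x \in s -> next t x = next s x ->
    next t (next s x) = next s (next s x).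
  move=> xs nx; have [_ nn] := next_next us s3 xs.
  have : [set next s x; next s (next s x)] \in edgeset s.
    by rewrite inE; apply/mapP; exists (next s x); rewrite ?mem_next.
  rewrite E => /edgeset_next -[] // _ [] // h.
  by move: nn; rewrite h -nx prev_next // eqxx.
have [i s' Es] := rot_to x0s; have [j t' Et] := rot_to (inE' _ x0s).
have tra u k r : uniq u -> rot k u = x0 :: r ->
    x0 :: r = traject (next u) x0 (size u).
  move=> uu Eu; have : fcycle (next u) (rot k u).
    by rewrite rot_cycle cycle_next.
  rewrite Eu /= rcons_path => /andP[/fpathP[n nE] _].
  by rewrite -(size_rot k) Eu [r]nE /= size_traject.
have : x0 :: t' = x0 :: s'.
  rewrite (tra _ _ _ us Es) (tra _ _ _ ut Et) -sz.
  elim: (size s) x0 x0s nx0 {Es Et tra} => //= n IH x xs nx.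
  by rewrite nx IH ?mem_next ?step.
rewrite -Es -Et => h; exists (rot_add s i (size s - j)).
by rewrite -rot_rot_add -h -[LHS](rotK j) /rotr size_rot sz.
Qed.

Lemma edgeset_inj s t : uniq s -> uniq t -> 2 < size s -> 2 < size t ->
  edgeset s = edgeset t <-> exists n, t = rot n s \/ t = rot n (rev s).
Proof.
move=> us ut s3 t3; split=> [E|[n [->|->]]]; last first.
- by rewrite edgeset_rot ?rev_uniq // edgeset_rev.
- by rewrite edgeset_rot.
have [x xs] : exists x, x \in s.
  by case: (s) s3 => // x r _; exists x; rewrite mem_head.
have : [set x; next s x] \in edgeset t by rewrite -E inE; apply/mapP; exists x.
case/edgeset_next => // _ [] nx.
  by have [n ->] := edgeset_inj1 us ut s3 t3 E xs (esym nx); exists n; left.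
have [||||n rt] := @edgeset_inj1 s (rev t) x us _ s3 _ _ xs;
  rewrite ?rev_uniq ?size_rev ?edgeset_rev ?next_rev //.
exists (size (rev s) - n); right.
by rewrite -[t]revK rt rev_rot.
Qed.
End CyclicSequences.

Section Hypergraph.

Variable T : finType.

(* The vertex set is a subset of the ambient type T, so that subhypergraphs   *)
(* may drop vertices. Edges form a set: multiple edges are excluded by        *)
(* construction, and "simple" below excludes loops.                           *)
Definition hypergraph_axiom (VE : {set T} * {set {set T}}) : bool :=
  (VE.1 != set0) && [forall e in VE.2, (e != set0) && (e \subset VE.1)].

Record hypergraph := Hypergraph {
  hypergraph_val : {set T} * {set {set T}};
  _ : hypergraph_axiom hypergraph_val
}.

HB.instance Definition _ := [isSub for hypergraph_val].
HB.instance Definition _ := [Finite of hypergraph by <:].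

Definition vertices (H : hypergraph) : {set T} := (val H).1.
Definition edges (H : hypergraph) : {set {set T}} := (val H).2.

Definition simple (H : hypergraph) : bool := [forall e in edges H, #|e| != 1].

Definition subhypergraph (H' H : hypergraph) : bool :=
  (vertices H' \subset vertices H) && (edges H' \subset edges H).

Definition two_partition (e : {set T}) (P : {set {set T}}) : bool :=
  partition P e && (#|P| == 2).

Definition is_part (e S : {set T}) : bool :=
  [exists S' : {set T}, two_partition e [set S; S']].

Definition index_set (H : hypergraph) : {set {set T}} :=
  [set S : {set T} | [exists e in edges H, is_part e S]]
    :|: [set [set v] | v in vertices H].

Definition e_index (H : hypergraph) : nat := #|index_set H|.

Definition unified_matrix (R : pzRingType) (H : hypergraph) :
    'M[R]_(e_index H) :=
  \matrix_(i, j)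
    ([exists e in edges H, two_partition e [set enum_val i; enum_val j]])%:R%R.

(* The walk S_0, e_1, S_1, ..., e_n, S_n is given by its initial part S_0 and *)
(* the sequence w = [:: (e_1, S_1); ...; (e_n, S_n)].                         *)
Fixpoint exact_walk (H : hypergraph) (S0 : {set T})
    (w : seq ({set T} * {set T})) : bool :=
  if w is (e, S1) :: w' then
    [&& e \in edges H, two_partition e [set S0; S1] & exact_walk H S1 w']
  else true.

(* As S_n = S_0, uniqueness of S_1, ..., S_n says that the internal parts are *)
(* distinct from each other and from S_0.                                     *)
Definition exact_cycle_walk (H : hypergraph) (S0 : {set T})
    (w : seq ({set T} * {set T})) : bool :=
  [&& exact_walk H S0 w, 3 <= size (undup (unzip1 w)),
      last S0 (unzip2 w) == S0 & uniq (unzip2 w)].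

(* The 2-partitions {S_0, S_1}, ..., {S_{n-1}, S_n} traversed by a walk.      *)
Definition trace (S0 : {set T}) (w : seq ({set T} * {set T})) :
    {set {set {set T}}} :=
  [set P in pairmap (fun S S' : {set T} => [set S; S']) S0 (unzip2 w)].

(* Exact cycles are counted, as usual, irrespective of starting part and      *)
(* direction; hence a cycle is represented by its trace, which determines it  *)
(* up to rotation and reversal (eq_trace). The bound on the length is         *)
(* vacuous, see exact_cyclesP. The length of the cycle represented by C is    *)
(* #|C| (card_trace) and its set of parts is finset's cover C (cover_trace).  *)
Definition exact_cycles (H : hypergraph) : {set {set {set {set T}}}} :=
  [set C : {set {set {set T}}} |
    [exists n : 'I_(#|{set T}|.+1), exists S0 : {set T},
     exists w : n.-tuple ({set T} * {set T}),
       exact_cycle_walk H S0 w && (C == trace S0 w)]].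

Lemma exact_cyclesP (H : hypergraph) (C : {set {set {set T}}}) :
  reflect (exists S0 w, exact_cycle_walk H S0 w /\ C = trace S0 w)
          (C \in exact_cycles H).
Proof.
rewrite inE; apply: (iffP existsP).
  by move=> [n /existsP[S0 /existsP[w /andP[cw /eqP->]]]]; exists S0, w.
move=> [S0 [w [cw ->]]].
have lew : size w < #|{set T}|.+1.
  case/and4P: cw => _ _ _ uw.
  by rewrite ltnS -(size_map snd) -(card_uniqP uw) max_card.
exists (Ordinal lew); apply/existsP; exists S0; apply/existsP.
by exists (in_tuple w); rewrite /= cw eqxx.
Qed.

Lemma card_trace (H : hypergraph) (S0 : {set T})
    (w : seq ({set T} * {set T})) :
  exact_cycle_walk H S0 w -> #|trace S0 w| = size w.
Proof.
case/and4P=> _ s3 /eqP lw uw.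
have {s3} : 2 < size (unzip2 w).
  by rewrite size_map -(size_map fst w) (leq_trans s3) ?size_undup.
rewrite /trace -(size_map snd w) -/(unzip2 w).
move: (unzip2 w) lw uw => s ls us n3.
set f := fun S S' : {set T} => [set S; S'].
have nE i : i < size s ->
    nth S0 (S0 :: s) i = nth S0 s (if i is i'.+1 then i' else (size s).-1).
  by case: i => [|i] //= _; rewrite nth_last ls.
rewrite cardsE (card_uniqP _) ?size_pairmap //.
apply: (wlog_neg); case/(uniqPn set0) => i [j []].
rewrite size_pairmap => ij js.
have is_ : i < size s by exact: ltn_trans js.
rewrite !(nth_pairmap S0) // !nE // /f => /setP E.
have := E (nth S0 s i); have := E (nth S0 s j).
rewrite !inE !eqxx !orbT; move: ij js is_ {nE E}.
case: i => [|i]; case: j => [|j] //= ij js is_; rewrite !nth_uniq ?prednK //;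
  by [lia | exact: ltnW | rewrite (leq_trans _ n3)].
Qed.

Lemma cover_trace (H : hypergraph) (S0 : {set T})
    (w : seq ({set T} * {set T})) :
  exact_cycle_walk H S0 w -> cover (trace S0 w) = [set S in unzip2 w].
Proof.
case/and4P=> _ s3 /eqP lw uw; apply/setP=> S; rewrite inE.
have {s3} : 0 < size (unzip2 w).
  have /(leq_trans s3) := size_undup (unzip1 w).
  by rewrite !size_map; apply: leq_trans.
rewrite /trace; move: (unzip2 w) lw uw => s ls us n0.
have S0s : S0 \in s by case: s ls n0 {us} => //= x s <-; rewrite mem_last.
apply/bigcupP/idP => [[P] | Ss].
  rewrite inE => /(nthP set0)[i]; rewrite size_pairmap => is_ <-.
  rewrite (nth_pairmap S0) // !inE => /orP[] /eqP -> {S}; last exact: mem_nth.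
  by case: i is_ => [|i] is_ //=; apply: mem_nth; apply: ltnW.
have /(nthP S0)[i is_ <-] := Ss.
exists [set nth S0 (S0 :: s) i; nth S0 s i]; last by rewrite !inE eqxx orbT.
rewrite inE -(nth_pairmap S0 set0 (fun S S' : {set T} => [set S; S'])) //.
by rewrite mem_nth // size_pairmap.
Qed.

Lemma eq_trace (H : hypergraph) (S1 S2 : {set T})
    (w1 w2 : seq ({set T} * {set T})) :
  exact_cycle_walk H S1 w1 -> exact_cycle_walk H S2 w2 ->
  trace S1 w1 = trace S2 w2 <->
  exists n, unzip2 w2 = rot n (unzip2 w1) \/
            unzip2 w2 = rot n (rev (unzip2 w1)).
Proof.
have sz w : 3 <= size (undup (unzip1 w)) -> 2 < size (unzip2 w).
  move=> /leq_trans -/(_ _ (size_undup _)).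
  by rewrite !size_map.
case/and4P=> _ /sz s1 /eqP l1 u1 /and4P[_ /sz s2 /eqP l2 u2].
by rewrite /trace !pairmap_edgeset //; apply: edgeset_inj.
Qed.

Definition disjoint_cycles (CC : {set {set {set {set T}}}}) : bool :=
  [forall C in CC, forall D in CC, (C != D) ==> [disjoint cover C & cover D]].

Definition cycles_cover (CC : {set {set {set {set T}}}}) : {set {set T}} :=
  \bigcup_(C in CC) cover C.

(* The last clause reads "either ... or at most one" as an exclusive choice:  *)
(* S lies in the cover of the cycles and in no member of EE, or outside that  *)
(* cover and in at most one member of EE.                                     *)
Definition elementary (H : hypergraph) (q : nat)
    (X : hypergraph * {set {set {set {set T}}}} * {set {set {set T}}}) :
    bool :=
  let: (H', CC, EE) := X in
  [&& 2 <= q <= e_index H,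
      subhypergraph H' H,
      (CC \subset exact_cycles H') && disjoint_cycles CC,
      [forall P in EE, exists e in edges H', two_partition e P],
      \sum_(C in CC) #|C| + 2 * #|EE| == q
    & [forall S in cycles_cover CC :|: cover EE,
        (S \in cycles_cover CC) + #|[set P in EE | S \in P]| <= 1]].

(* Elementary q-subhypergraphs up to the choice of the host H': the clauses   *)
(* of elementary allow H' to have vertices and edges unrelated to CC and EE,  *)
(* whereas the coefficient formula counts every pair (CC, EE) once (counting  *)
(* hosts too, the formula fails for one edge {a, b} plus an isolated vertex). *)
Definition elementary_pairs (H : hypergraph) (q : nat) :
    {set {set {set {set {set T}}}} * {set {set {set T}}}} :=
  [set (X.1.2, X.2) | X in elementary H q].

End Hypergraph.

(* Main.v *)
Require Import Defs.
From mathcomp Require Import all_boot all_order all_algebra all_fingroup.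
From mathcomp Require Import zify.

Set Implicit Arguments.
Unset Strict Implicit.
Unset Printing Implicit Defensive.
Import GRing.Theory.

(** The unified matrix is the adjacency matrix of a graph without loops on the
    parts: S and S' are adjacent when {S, S'} is a 2-partition of an edge. The
    theorem is Sachs' coefficient theorem for this graph.

    Expand det (x - U) over permutations. As U has a zero diagonal, the term of
    a permutation is a monomial whose exponent is the number of fixed points,
    so the coefficient c_t collects the permutations moving exactly t indices
    (char_poly_coef_moved), and only those survive that send each part they
    move to an adjacent one. The sign of such a permutation, together with the
    factor (-1)^t from the entries -U, is (-1)^m, with m the number of its
    nontrivial orbits (odd_circuits).

    Forget the direction in which a permutation p runs through its orbits: an
    orbit becomes the set of the pairs {x, p x} along it, here called a
    circuit. A circuit of length two is one pair, a longer one is a cycle of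
    the graph. The systems of circuits that arise are all the families with
    disjoint supports (realize_circuits), that is, the elementary
    subhypergraphs up to their host (elementary_pairsP), and a system with c
    long circuits comes from exactly 2^c permutations, since each long circuit
    can be run through in two directions (card_same_circuits). Grouping the
    permutations by their circuits gives the formula.

    One point belongs to hypergraphs rather than to graphs: an exact cycle must
    have three distinct edges, whereas a cycle of the graph only has three
    distinct parts. In fact the latter implies the former (three_edges). *)

(** * Permutations and their undirected circuits *)

Section Circuits.
Local Open Scope group_scope.
Variable V : finType.
Implicit Types (p q : {perm V}) (x y z : V) (C : {set {set V}}).

Definition moved p := [set x | p x != x].

(** The orbit of x as an undirected closed walk. If p exchanges x and p x, it is
    the singleton of the pair {x, p x}. *)
Definition circuit p x : {set {set V}} :=
  [set [set y; p y] | y in porbit p x].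

Definition circuits p : {set {set {set V}}} :=
  [set circuit p x | x in moved p].

Lemma porbit_step p x y : (p y \in porbit p x) = (y \in porbit p x).
Proof.
by rewrite -!eq_porbit_mem; have := porbit_perm p 1 y; rewrite expg1 => ->.
Qed.

Lemma porbit_stepV p x y : (p^-1 y \in porbit p x) = (y \in porbit p x).
Proof. by rewrite -(porbitV p) porbit_step. Qed.

Lemma cover_circuit p x : cover (circuit p x) = porbit p x.
Proof.
apply/setP=> z; apply/bigcupP/idP => [[_ /imsetP[y yx ->]]|zx].
  by rewrite !inE => /orP[]/eqP-> //; rewrite porbit_step.
by exists [set z; p z]; rewrite ?set21 //; apply/imsetP; exists z.
Qed.

Lemma eq_circuit p x y : (circuit p x == circuit p y) = (x \in porbit p y).
Proof.
apply/eqP/idP=> [/(congr1 (@cover _))|]; rewrite ?cover_circuit.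
  by move/eqP; rewrite eq_porbit_mem.
by rewrite -eq_porbit_mem /circuit => /eqP ->.
Qed.

Lemma circuit_step p x : circuit p (p x) = circuit p x.
Proof. by apply/eqP; rewrite eq_circuit porbit_step porbit_id. Qed.

Lemma porbit_moved p x y :
  y \in porbit p x -> (y \in moved p) = (x \in moved p).
Proof.
move=> /porbitP[n ->]; rewrite !inE -permM -expgSr expgS permM.
by rewrite (inj_eq perm_inj).
Qed.

Lemma bigcup_circuits p : \bigcup_(C in circuits p) cover C = moved p.
Proof.
apply/setP=> y; apply/bigcupP/idP => [[C /imsetP[x mx ->]]|my].
  by rewrite cover_circuit => /porbit_moved->.
exists (circuit p y); first by apply/imsetP; exists y.
by rewrite cover_circuit porbit_id.
Qed.

Lemma circuitsP p C x : C \in circuits p -> x \in cover C -> C = circuit p x.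
Proof.
by move=> /imsetP[y _ ->]; rewrite cover_circuit -eq_circuit => /eqP.
Qed.

Lemma circuits_disjoint p C D :
  C \in circuits p -> D \in circuits p -> C != D ->
  [disjoint cover C & cover D].
Proof.
move=> Cp Dp; apply: contraNT => /pred0Pn[x /andP[/= xC xD]].
by rewrite (circuitsP Cp xC) -(circuitsP Dp xD).
Qed.

Lemma card_moved p : #|moved p| = \sum_(C in circuits p) #|cover C|.
Proof.
rewrite -sum1_card (partition_big_imset (circuit p)); apply: eq_bigr => C Cp.
rewrite -sum1_card; apply: eq_bigl => x; apply/andP/idP => [[_ /eqP <-]|xC].
  by rewrite cover_circuit porbit_id.
rewrite -(circuitsP Cp xC) eqxx -bigcup_circuits; split=> //.
by apply/bigcupP; exists C.
Qed.

Lemma porbit_fixed p x y : p x = x -> (y \in porbit p x) = (y == x).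
Proof.
move=> px; apply/idP/eqP => [/porbitP[n ->]|->]; last exact: porbit_id.
by elim: n => [|n IH]; rewrite ?perm1 // expgSr permM IH.
Qed.

(** The sign of p is that of #|V| minus the number of orbits, in which fixed
    points cancel; what remains counts the nontrivial orbits. *)
Lemma odd_circuits p : odd #|moved p| (+) p = odd #|circuits p|.
Proof.
rewrite /odd_perm -(cardsC (moved p)).
have -> : porbits p = porbit p @: moved p :|: porbit p @: ~: moved p.
  rewrite -imsetU setUCr; apply/setP=> A.
  by apply/imsetP/imsetP => -[x _ ->]; exists x.
have -> : porbit p @: moved p = (@cover V) @: circuits p.
  by rewrite -imset_comp; apply: eq_imset => x /=; rewrite cover_circuit.
have covI : {in circuits p &, injective (@cover V)}.
  move=> C D Cp Dp eCD; have /imsetP[x _ defC] := Cp.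
  have xC : x \in cover C by rewrite defC cover_circuit porbit_id.
  by rewrite (circuitsP Cp xC) -(circuitsP Dp) -?eCD.
have fixI : {in ~: moved p &, injective (porbit p)}.
  move=> x y; rewrite !inE !negbK => /eqP px /eqP py E.
  by apply/eqP; rewrite -(porbit_fixed _ py) -E porbit_id.
rewrite cardsU (card_in_imset covI) (card_in_imset fixI).
suff /eqP-> : (@cover V @: circuits p) :&: (porbit p @: ~: moved p) == set0.
  by rewrite cards0 subn0 !oddD; do 3!case: odd.
apply/set0Pn => -[A /setIP[/imsetP[C Cp ->] /imsetP[y]]].
have /imsetP[x mx ->] := Cp; rewrite cover_circuit => my E; move: my.
by rewrite in_setC (@porbit_moved p x y) ?mx // E porbit_id.
Qed.

(** Reversing p along the orbits whose circuits lie in B. Both p and its inverse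
    preserve every orbit, so reversing the other orbits instead gives the
    inverse function, which is why flip_fun is a permutation. *)
Definition flip_fun p (B : {set {set {set V}}}) x :=
  if circuit p x \in B then p^-1 x else p x.

Lemma circuit_stepV p x : circuit p (p^-1 x) = circuit p x.
Proof. by rewrite -{2}[x](permKV p) circuit_step. Qed.

Lemma flip_funK p B : cancel (flip_fun p B) (flip_fun p (~: B)).
Proof.
move=> x; rewrite /flip_fun.
case xB: (circuit p x \in B).
  by rewrite circuit_stepV in_setC xB permKV.
by rewrite circuit_step in_setC xB permK.
Qed.

Definition flip p B : {perm V} := perm (can_inj (flip_funK p B)).

Lemma flipE p B x : flip p B x = if circuit p x \in B then p^-1 x else p x.
Proof. by rewrite permE. Qed.

Lemma circuitV p x : circuit p^-1 x = circuit p x.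
Proof.
rewrite /circuit porbitV; apply/setP=> P.
apply/imsetP/imsetP => -[y yx ->].
  by exists (p^-1 y); rewrite ?porbit_stepV // permKV setUC.
by exists (p y); rewrite ?porbit_step // permK setUC.
Qed.

Lemma eq_in_porbit p q x : {in porbit p x, q =1 p} -> porbit q x = porbit p x.
Proof.
move=> qp; have E n : (q ^+ n) x = (p ^+ n) x.
  elim: n => [|n IH]; first by rewrite !perm1.
  by rewrite !expgSr !permM IH qp // mem_porbit.
by apply/setP=> y; apply/porbitP/porbitP=> -[n ->]; exists n; rewrite E.
Qed.

Lemma eq_in_circuit p q x :
  {in porbit p x, q =1 p} -> circuit q x = circuit p x.
Proof.
move=> qp; rewrite /circuit (eq_in_porbit qp).
by apply: eq_in_imset => y /qp ->.
Qed.

Lemma circuit_flip p B x : circuit (flip p B) x = circuit p x.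
Proof.
have Ec y : y \in porbit p x -> circuit p y = circuit p x.
  by rewrite -eq_circuit => /eqP.
case xB: (circuit p x \in B).
  rewrite -[RHS]circuitV; apply: eq_in_circuit => y.
  by rewrite porbitV flipE => /Ec ->; rewrite xB.
by apply: eq_in_circuit => y; rewrite flipE => /Ec ->; rewrite xB.
Qed.

Lemma circuits_flip p B : circuits (flip p B) = circuits p.
Proof.
have movedE : moved (flip p B) = moved p.
  apply/setP=> x; rewrite !inE flipE; case: ifP => // _.
  by rewrite -(inj_eq (@perm_inj _ p)) permKV eq_sym.
by rewrite /circuits movedE; apply: eq_imset => x; rewrite circuit_flip.
Qed.

Lemma porbit2 p x : p (p x) = x -> porbit p x = [set x; p x].
Proof.
move=> ppx; apply/setP=> y; rewrite !inE; apply/idP/idP.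
  case/porbitP=> n ->; elim: n => [|n IH]; first by rewrite perm1 eqxx.
  rewrite expgSr permM; case/orP: IH => /eqP->; rewrite ?ppx eqxx ?orbT //.
by case/orP=> /eqP->; rewrite ?porbit_step porbit_id.
Qed.

(** The length of a circuit C is #|cover C|, as its cover is the orbit; #|C| is
    1 rather than 2 for an exchange. Long circuits are the ones that can be run
    through in two directions: on shorter orbits p is its own inverse. *)
Definition long_circuits (S : {set {set {set V}}}) :=
  [set C in S | 2 < #|cover C|].

Lemma long_circuit p x :
  p (p x) != x -> circuit p x \in long_circuits (circuits p).
Proof.
move=> ppx; have mx : p x != x by apply: contraNneq ppx => px; rewrite !px.
rewrite !inE cover_circuit; apply/andP; split.
  by apply/imsetP; exists x; rewrite ?inE.
have sub3 : [set x; p x; p (p x)] \subset porbit p x.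
  by rewrite !subUset !sub1set !porbit_step !porbit_id.
rewrite (leq_trans _ (subset_leq_card sub3)) //.
by rewrite -setUA !cardsU1 cards1 !inE ![x == _]eq_sym negb_or mx ppx
  (inj_eq perm_inj) eq_sym mx.
Qed.

Lemma flip_inj p :
  {in powerset (long_circuits (circuits p)) &, injective (flip p)}.
Proof.
move=> B D; rewrite !powersetE => /subsetP sB /subsetP sD E.
have memE C : C \in long_circuits (circuits p) -> (C \in B) = (C \in D).
  rewrite inE => /andP[/imsetP[x _ ->]]; rewrite cover_circuit.
  move=> n3; have := congr1 (fun q : {perm V} => q x) E; rewrite !flipE.
  have : p^-1 x != p x.
    rewrite -(inj_eq (@perm_inj _ p)) permKV.
    by apply: contraTneq n3 => /esym /porbit2 ->; rewrite cards2; case: eqP.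
  by case: ifP; case: ifP => // _ _ /eqP ne // h; case: ne.
apply/setP=> C; apply/idP/idP => h.
  by rewrite -memE // sB.
by rewrite memE // sD.
Qed.

Lemma same_circuits p q x :
  circuits q = circuits p -> circuit q x = circuit p x.
Proof.
move=> E; have [mx|mx] := boolP (x \in moved p).
  have := mx; rewrite -bigcup_circuits => /bigcupP[C Cp xC].
  by rewrite -(circuitsP Cp xC) -(circuitsP _ xC) // E.
have mx' : x \notin moved q by rewrite -bigcup_circuits E bigcup_circuits.
move: mx mx'; rewrite !inE !negbK => /eqP px /eqP qx.
have fixc (r : {perm V}) : r x = x -> circuit r x = [set [set x]].
  move=> rx; have -> : [set [set x]] = [set [set y; r y] | y in [set x]].
    by rewrite imset_set1 rx setUid.
  have -> : [set x] = porbit r x by apply/setP=> y; rewrite porbit_fixed // inE.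
  by [].
by rewrite !fixc.
Qed.

Lemma set2_injr (x y z : V) : [set x; y] = [set x; z] -> y = z.
Proof.
move=> /setP E; have := E y; have := E z; rewrite !inE !eqxx !orbT.
by case/orP=> /eqP-> // /esym; rewrite orbb => /eqP.
Qed.

(** The pair {x, q x} lies in the circuit of p, so it is {x, p x} or
    {p^-1 x, x}. *)
Lemma same_circuit_step p q x :
  circuit q x = circuit p x -> q x = p x \/ q x = p^-1 x.
Proof.
move=> E; have : [set x; q x] \in circuit p x.
  by rewrite -E; apply/imsetP; exists x; rewrite ?porbit_id.
case/imsetP=> y _ E2; have : x \in [set y; p y] by rewrite -E2 set21.
case/set2P=> xE; first by left; move: E2; rewrite -xE => /set2_injr.
right; move: E2; rewrite -xE setUC [RHS]setUC setUC => /set2_injr ->.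
by rewrite xE permK.
Qed.

(** A direction agreed upon at one point propagates: if q followed p from y to
    p y and then turned back, {y, p y} would be the whole orbit of q, hence of
    p, and turning back would be what p does too. *)
Lemma same_circuit_dir p q x : circuit q x = circuit p x ->
  q x = p x -> {in porbit p x, q =1 p}.
Proof.
move=> E qx _ /porbitP[n ->]; elim: n => [|n IH]; first by rewrite perm1.
set y := (p ^+ n) x in IH *.
have Ey : circuit q (p y) = circuit p (p y).
  rewrite circuit_step -[in LHS]IH circuit_step.
  have yp : y \in porbit p x by rewrite mem_porbit.
  have yq : y \in porbit q x by rewrite -(cover_circuit q) E cover_circuit.
  by move: yp yq; rewrite -!eq_circuit => /eqP -> /eqP ->.
rewrite expgSr permM -/y; have [//|] := same_circuit_step Ey.
rewrite permK => qpy; rewrite qpy.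
have qqy : q (q y) = y by rewrite IH.
move: (porbit2 qqy); rewrite -(cover_circuit q) -(circuit_step q) IH Ey.
rewrite circuit_step cover_circuit => /setP/(_ (p (p y))).
rewrite !porbit_step porbit_id !inE (inj_eq perm_inj) => /esym/orP[]/eqP h.
  by rewrite h.
by rewrite !h.
Qed.

(** On each orbit q is p or its inverse; flip those on which it is not p. *)
Lemma same_circuits_flip p q : circuits q = circuits p ->
  exists2 B, B \in powerset (long_circuits (circuits p)) & q = flip p B.
Proof.
move/same_circuits => E; exists [set circuit p x | x in [pred x | q x != p x]].
  rewrite powersetE; apply/subsetP=> _ /imsetP[x qx ->]; apply: long_circuit.
  apply: contraNneq qx => ppx; have [-> //|->] := same_circuit_step (E x).
  by rewrite -{1}ppx permK.
apply/permP=> x; rewrite flipE; case: imsetP => [[y qy xy]|nB]; last first.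
  by apply/eqP/negPn/negP=> qx; apply: nB; exists x.
have [qx|//] := same_circuit_step (E x); case/negP: qy; apply/eqP.
by apply: (same_circuit_dir (E x) qx); rewrite -eq_circuit xy.
Qed.

Lemma card_same_circuits p :
  #|[set q | circuits q == circuits p]| = (2 ^ #|long_circuits (circuits p)|)%N.
Proof.
rewrite -card_powerset -(card_in_imset (@flip_inj p)); congr #|pred_of_set _|.
apply/setP=> q; rewrite inE; apply/eqP/imsetP=> [|[B _ ->]].
  by case/same_circuits_flip=> B; exists B.
exact: circuits_flip.
Qed.

Lemma circuit_edgeset p x s :
  uniq s -> s =i porbit p x -> {in s, next s =1 p} -> circuit p x = edgeset s.
Proof.
move=> us sE nx; apply/setP=> P; rewrite inE.
apply/imsetP/mapP=> -[y ys ->].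
  by rewrite -sE in ys; exists y; rewrite ?nx.
by exists y; rewrite -?sE ?nx.
Qed.

Lemma porbit_next p s x : uniq s -> {in s, p =1 next s} -> x \in s ->
  s =i porbit p x.
Proof.
move=> us ps xs y; apply/idP/porbitP => [ys|[n ->]]; last first.
  by elim: n => [|n IH]; rewrite ?perm1 // expgSr permM ps // mem_next.
have /rot_to[i r Er] := xs.
have ur : uniq (rot i s) by rewrite rot_uniq.
have : y \in rot i s by rewrite mem_rot.
have pn z n : z \in s -> iter n (next s) z = (p ^+ n) z.
  move=> zs; elim: n => [|n IH]; first by rewrite perm1.
  rewrite iterS IH expgSr permM ps //.
  by elim: n {IH} => [|n IH]; rewrite ?perm1 // expgSr permM ps // mem_next.
have : fcycle (next s) (rot i s) by rewrite rot_cycle cycle_next.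
rewrite Er /= rcons_path => /andP[/fpathP[n ->] _].
by rewrite -trajectS => /trajectP[k _ ->]; exists k; rewrite pn.
Qed.

Lemma mem_edgeset (s : seq V) x : x \in s -> [set x; next s x] \in edgeset s.
Proof. by move=> xs; rewrite inE; apply/mapP; exists x. Qed.

Lemma cover_edgeset (s : seq V) : uniq s -> cover (edgeset s) = [set x in s].
Proof.
move=> us; apply/setP=> x; rewrite inE; apply/bigcupP/idP.
  by case=> P; rewrite inE => /mapP[y ys ->] /set2P[]-> //; rewrite mem_next.
by move=> xs; exists [set x; next s x]; rewrite ?set21 ?mem_edgeset.
Qed.

(** Run through each member of S along a sequence that represents it and fix
    the points outside their covers. *)
Lemma realize_circuits (S : {set {set {set V}}}) :
  (forall C, C \in S -> exists s, [/\ uniq s, 1 < size s & C = edgeset s]) ->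
  {in S &, forall C D, C != D -> [disjoint cover C & cover D]} ->
  exists p, circuits p = S.
Proof.
move=> Sseq Sdis.
have /fin_all_exists[s sP] C : exists s : seq V,
    C \in S -> [/\ uniq s, 1 < size s & C = edgeset s].
  have [/Sseq[s sP]|] := boolP (C \in S); first by exists s.
  by exists [::].
(* Outside the covers sel x is empty, and next [::] is the identity. *)
pose sel x := if [pick C in S | x \in cover C] is Some C then s C else [::].
have selE C x : C \in S -> x \in s C -> sel x = s C.
  move=> CS xC; have [uC _ CE] := sP C CS.
  rewrite /sel; case: pickP => [D /andP[DS xD]|/(_ C)]; last first.
    by rewrite /= CS /= {1}CE cover_edgeset // inE xC.
  have [-> //|ne] := eqVneq D C; case/pred0Pn: (Sdis _ _ DS CS ne).
  by exists x; rewrite /= xD {1}CE cover_edgeset // inE.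
have selP x : (exists C, [/\ C \in S, x \in s C & sel x = s C]) \/ sel x = [::].
  rewrite /sel; case: pickP => [D /andP[DS xD]|]; [left|by right].
  have [uD _ DE] := sP D DS; exists D; split=> //.
  by move: xD; rewrite {1}DE cover_edgeset // inE.
have K : cancel (fun x => next (sel x) x) (fun x => prev (sel x) x).
  move=> x /=; case: (selP x) => [[C [CS xC xE]]|xE]; last by rewrite xE /= xE.
  have [uC _ _] := sP C CS.
  by rewrite xE (selE C) ?mem_next // prev_next.
exists (perm (can_inj K)); set p := perm _.
have pE C : C \in S -> {in s C, p =1 next (s C)}.
  by move=> CS x xC; rewrite permE (selE C).
have cE C x : C \in S -> x \in s C -> circuit p x = C.
  move=> CS xC; have [uC _ CE] := sP C CS; rewrite [RHS]CE.
  apply: circuit_edgeset => // [|y yC]; first exact: porbit_next (pE C CS) xC.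
  by rewrite (pE C CS).
apply/setP=> C; apply/imsetP/idP => [[x mx ->]|CS].
  move: mx; rewrite inE permE; case: (selP x) => [[D [DS xD xE]]|->].
    by rewrite (cE D).
  by rewrite eqxx.
have [uC sz CE] := sP C CS.
case E : (s C) (pE C CS) uC sz => [|x [|y r]] // pC uC _.
exists x; last by rewrite (cE C) // E mem_head.
rewrite inE pC ?mem_head //= eqxx.
by move: uC; rewrite /= inE negb_or eq_sym => /andP[/andP[]].
Qed.

End Circuits.

(** * Coefficients of the characteristic polynomial *)

Section CharPoly.
Local Open Scope ring_scope.

(** With a zero diagonal, the factors of the determinant of x - A are x at the
    fixed points of s and minus an entry of A at the moved ones. *)
Lemma char_poly_coef_moved (R : comNzRingType) n (A : 'M[R]_n) t :
  (forall i, A i i = 0) -> (t <= n)%N ->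
  (char_poly A)`_(n - t) = \sum_(s : 'S_n | #|moved s| == t)
    (-1) ^+ (t + s) * \prod_(i in moved s) A i (s i).
Proof.
move=> A0 tn; rewrite /char_poly /determinant coef_sum [RHS]big_mkcond /=.
apply: eq_bigr => s _; rewrite (bigID [in moved s]) /=.
have -> : \prod_(i | i \notin moved s) char_poly_mx A i (s i) =
    'X ^+ (n - #|moved s|).
  have -> : (n - #|moved s| = #|~: moved s|)%N.
    by rewrite [RHS]cardsCs setCK card_ord.
  rewrite -prodr_const.
  apply: eq_big => [i|i]; first by rewrite !inE.
  by rewrite inE negbK => /eqP si; rewrite !mxE si A0 eqxx subr0.
have -> : \prod_(i in moved s) char_poly_mx A i (s i) =
    ((-1) ^+ #|moved s| * \prod_(i in moved s) A i (s i))%:P.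
  rewrite -prodr_const -big_split /= rmorph_prod; apply: eq_bigr => i.
  rewrite inE eq_sym => /negPf si.
  by rewrite !mxE si sub0r mulN1r rmorphN.
rewrite -signr_odd -[(-1) ^+ odd s]/((-1) ^+ odd s).
have -> : (-1) ^+ (odd s) = ((-1) ^+ odd s)%:P :> {poly R}.
  by rewrite rmorphXn rmorphN1.
rewrite mulrA -rmorphM /= coefCM coefXn.
have le_n : (#|moved s| <= n)%N by rewrite -[leqRHS]card_ord max_card.
have -> : (n - t == n - #|moved s|)%N = (#|moved s| == t).
  by apply/eqP/eqP; lia.
case: eqP => [->|_]; last by rewrite mulr0.
rewrite mulr1 signr_odd mulrA exprD; congr (_ * _).
exact: mulrC.
Qed.

End CharPoly.

Section Embed.
Local Open Scope group_scope.
Variables (I V : finType) (f : I -> V).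
Hypothesis f_inj : injective f.
Implicit Types s : {perm I}.

(** This turns permutations of matrix indices into permutations of parts, whose
    circuits can be compared with exact cycles. *)
Definition embed_fun s v :=
  if [pick i | f i == v] is Some i then f (s i) else v.

Lemma embed_funE s i : embed_fun s (f i) = f (s i).
Proof.
rewrite /embed_fun; case: pickP => [j /eqP/f_inj -> //|/(_ i)].
by rewrite eqxx.
Qed.

Lemma embed_fun_out s v : v \notin codom f -> embed_fun s v = v.
Proof.
rewrite /embed_fun; case: pickP => // i /eqP <- /negP[]; exact: codom_f.
Qed.

Lemma embed_funK s : cancel (embed_fun s) (embed_fun s^-1).
Proof.
move=> v; have [/codomP[i ->]|nv] := boolP (v \in codom f).
  by rewrite !embed_funE permK.
by rewrite !embed_fun_out // embed_fun_out.
Qed.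

Definition embed s : {perm V} := perm (can_inj (embed_funK s)).

Lemma embedE s i : embed s (f i) = f (s i).
Proof. by rewrite permE embed_funE. Qed.

Lemma embed_out s v : v \notin codom f -> embed s v = v.
Proof. by rewrite permE; apply: embed_fun_out. Qed.

Lemma embed_inj : injective embed.
Proof.
move=> s1 s2 E; apply/permP=> i; apply: f_inj.
by rewrite -!embedE E.
Qed.

Lemma moved_embed s : moved (embed s) = f @: moved s.
Proof.
apply/setP=> v; apply/idP/imsetP => [|[i]]; last first.
  by rewrite inE => si ->; rewrite inE embedE (inj_eq f_inj).
rewrite inE => mv.
have /codomP[i vE] : v \in codom f by apply: contraNT mv => /embed_out->.
by exists i => //; move: mv; rewrite vE embedE inE (inj_eq f_inj).
Qed.

Lemma card_moved_embed s : #|moved (embed s)| = #|moved s|.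
Proof. by rewrite moved_embed card_imset. Qed.

Lemma embedM s1 s2 : embed (s1 * s2) = embed s1 * embed s2.
Proof.
apply/permP=> v; rewrite permM.
have [/codomP[i ->]|nv] := boolP (v \in codom f).
  by rewrite !embedE permM.
by rewrite !embed_out // embed_out.
Qed.

Lemma embed_tperm i j : embed (tperm i j) = tperm (f i) (f j).
Proof.
apply/permP=> v; have [/codomP[k ->]|nv] := boolP (v \in codom f).
  by rewrite embedE !permE /= !(inj_eq f_inj) !(fun_if f).
rewrite embed_out // tpermD //; apply: contraNneq nv => <-; exact: codom_f.
Qed.

(** Write s as a product of transpositions, each of which embed sends to a
    transposition. *)
Lemma odd_embed s : embed s = s :> bool.
Proof.
have [ts -> _] := prod_tpermP s; elim: ts => [|[i j] ts IH].
  rewrite !big_nil odd_perm1; have -> : embed 1 = 1; last exact: odd_perm1.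
  by apply: (mulgI (embed 1)); rewrite -embedM !mulg1.
by rewrite !big_cons embedM !odd_permM IH embed_tperm !odd_tperm (inj_eq f_inj).
Qed.

Lemma embed_surj (p : {perm V}) :
  moved p \subset codom f -> exists s, embed s = p.
Proof.
move=> sp; have pf i : p (f i) \in codom f.
  have [pi|] := eqVneq (p (f i)) (f i); first by rewrite pi codom_f.
  move=> pi; apply: (subsetP sp); rewrite inE; apply: contraNneq pi.
  by move/perm_inj->.
have sI : injective (fun i => iinv (pf i)).
  by move=> i j /(congr1 f); rewrite !f_iinv => /perm_inj/f_inj.
exists (perm sI); apply/permP=> v.
have [/codomP[i ->]|nv] := boolP (v \in codom f).
  by rewrite embedE permE f_iinv.
rewrite embed_out //; apply/eqP; apply: contraNT nv; rewrite eq_sym => pv.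
by apply: (subsetP sp); rewrite inE.
Qed.

End Embed.

(** * Exact cycles as cycles of the graph on the parts *)

Section Parts.
Variable T : finType.
Implicit Types (H : hypergraph T) (a b c e S : {set T}) (P : {set {set T}}).
Implicit Types (C D : {set {set {set T}}}) (s : seq {set T}).

Definition splits_edge H P := [exists e in edges H, two_partition e P].

Lemma splits_edge_card H P : splits_edge H P -> #|P| = 2.
Proof. by case/exists_inP=> e _ /andP[_ /eqP]. Qed.

Lemma two_partition_set2 e a b : two_partition e [set a; b] ->
  e = a :|: b /\ [disjoint a & b].
Proof.
case/andP=> /and3P[/eqP <- /trivIsetP dis _]; rewrite cards2.
case: (eqVneq a b) => // ab _; split.
  by rewrite /cover bigcup_setU !big_set1.
by apply: dis; rewrite ?set21 ?set22.
Qed.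

Lemma splits_edge_set2 H a b : splits_edge H [set a; b] -> [disjoint a & b].
Proof. by case/exists_inP=> e _ /two_partition_set2[]. Qed.

Lemma disjoint_setU_inj a b c :
  [disjoint a & b] -> [disjoint c & b] -> a :|: b = c :|: b -> a = c.
Proof.
move=> /setDidPl ab /setDidPl cb E.
by have := congr1 (fun A => A :\: b) E; rewrite /= !setDUl setDv !setU0 ab cb.
Qed.

Lemma exact_walk_splits_edge H S0 w : exact_walk H S0 w ->
  all (splits_edge H) (pairmap (fun S S' => [set S; S']) S0 (unzip2 w)).
Proof.
elim: w S0 => //= -[e S1] w IH S0 /and3P[He Pe /IH -> /=].
by rewrite andbT; apply/exists_inP; exists e.
Qed.

Lemma splits_edge_exact_walk H S0 s :
  all (splits_edge H) (pairmap (fun S S' => [set S; S']) S0 s) ->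
  exact_walk H S0 (pairmap (fun S S' => (S :|: S', S')) S0 s).
Proof.
elim: s S0 => //= S1 s IH S0 /andP[/exists_inP[e He Pe] /IH ->].
by have [<- _] := two_partition_set2 Pe; rewrite He Pe.
Qed.

(** Consecutive edges differ, since a part and an edge determine the
    complementary part. With two edges in all they would alternate as e, f, e,
    f; the two parts of the middle f in e, f, e also are parts of e, so f is
    included in e, and likewise e in f. *)
Lemma three_edges H s : uniq s -> 2 < size s ->
  (forall P, P \in edgeset s -> splits_edge H P) ->
  2 < size (undup [seq y :|: next s y | y <- s]).
Proof.
move=> us n3 sp.
have dis y : y \in s -> [disjoint y & next s y].
  by move=> ys; apply: (@splits_edge_set2 H); apply: sp; exact: mem_edgeset.
pose e y := y :|: next s y.
have e1 y : y \in s -> e y != e (next s y).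
  move=> ys; apply/eqP=> E; have [_ /eqP[]] := next_next us n3 ys.
  apply: (@disjoint_setU_inj _ (next s y)); last first.
  - by rewrite -/(e y) E setUC.
  - exact: dis.
  by rewrite disjoint_sym dis ?mem_next.
have [y ys] : exists y, y \in s.
  by case: (s) n3 => // x r _; exists x; rewrite mem_head.
have ein z : z \in s -> e z \in undup [seq y :|: next s y | y <- s].
  by move=> zs; rewrite mem_undup; apply/mapP; exists z.
have [E0|ne0] := eqVneq (e (next s (next s y))) (e y); last first.
  apply: (@uniq_leq_size _ [:: e y; e (next s y); e (next s (next s y))]).
    by rewrite /= !inE negb_or e1 // eq_sym ne0 e1 ?mem_next.
  by move=> z; rewrite !inE => /or3P[]/eqP->; rewrite ein ?mem_next.
have ne1 : e (next s (next s (next s y))) != e (next s y).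
  apply: contraNneq (e1 y ys) => E1; rewrite eqEsubset; apply/andP; split.
    by rewrite -E0 subUset -{2}E1 subsetUr subsetUl.
  by rewrite subUset -{2}E0 subsetUr subsetUl.
apply: (@uniq_leq_size _
  [:: e (next s y); e (next s (next s y)); e (next s (next s (next s y)))]).
  by rewrite /= !inE negb_or e1 ?mem_next // eq_sym ne1 e1 ?mem_next.
by move=> z; rewrite !inE => /or3P[]/eqP->; rewrite ein ?mem_next.
Qed.

(** Exact cycles are exactly the cycles of the graph on the parts: the edges of
    the walk are the unions of consecutive parts, and there are three distinct
    ones by three_edges. *)
Lemma exact_cyclesE H C : C \in exact_cycles H <->
  exists s, [/\ uniq s, 2 < size s, C = edgeset s
              & forall P, P \in C -> splits_edge H P].
Proof.
split.
  case/exact_cyclesP=> S0 [w [cw ->]]; exists (unzip2 w).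
  case/and4P: cw => ww s3 /eqP lw uw; split=> //.
  - by rewrite size_map -(size_map fst w) (leq_trans s3) ?size_undup.
  - exact: pairmap_edgeset.
  - by move=> P; rewrite inE; apply/allP/exact_walk_splits_edge.
case=> s [us n3 -> sp]; apply/exact_cyclesP.
(* The walk starts at the last part, so that its later parts are just s. *)
pose S0 := last set0 s; have lS : last S0 s = S0 by rewrite /S0; case: (s).
exists S0, (pairmap (fun S S' => (S :|: S', S')) S0 s).
have w2 S1 : unzip2 (pairmap (fun S S' => (S :|: S', S')) S1 s) = s.
  by elim: (s) S1 => //= a r IH S1; rewrite IH.
split; last by rewrite /trace w2 pairmap_edgeset.
rewrite /exact_cycle_walk w2 lS eqxx us !andbT; apply/andP; split.
  apply: splits_edge_exact_walk; apply/allP=> P Ps; apply: sp.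
  by rewrite -(pairmap_edgeset us lS) inE.
have -> : unzip1 (pairmap (fun S S' => (S :|: S', S')) S0 s) =
          pairmap (fun S S' => S :|: S') S0 s.
  by elim: (s) (S0) => //= a r IH S1; rewrite IH.
rewrite (leq_trans (three_edges us n3 sp)) // uniq_leq_size ?undup_uniq //.
move=> e; rewrite !mem_undup => /mapP[y ys ->]; rewrite pairmap_prev //.
by apply/mapP; exists (next s y); rewrite ?mem_next // prev_next.
Qed.

Lemma card_exact_cycle H C : C \in exact_cycles H ->
  2 < #|C| /\ #|cover C| = #|C|.
Proof.
case/exact_cyclesP=> S0 [w [cw ->]].
rewrite (card_trace cw) (cover_trace cw) cardsE.
case/and4P: cw => _ s3 _ uw; rewrite (card_uniqP uw) size_map.
by rewrite -(size_map fst w) (leq_trans s3) ?size_undup.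
Qed.

End Parts.

(** * Elementary subhypergraphs and permutations *)

Section Pairs.
Variables (T : finType) (H : hypergraph T).
Notation V := {set T}.
Implicit Types (X : {set {set {set V}}} * {set {set V}}) (p q : {perm V}).

(** The common form of cycles and 2-partitions: a 2-partition P is the circuit
    of length two [set P]. *)
Definition circuits_of_pair X : {set {set {set V}}} :=
  X.1 :|: [set [set P] | P in X.2].

(** The inverse of circuits_of_pair: an exact cycle has at least three pairs, so
    it is not mistaken for a 2-partition. *)
Definition pair_of_circuits (S : {set {set {set V}}}) :
    {set {set {set V}}} * {set {set V}} :=
  (long_circuits S, [set P | [set P] \in S]).

Lemma circuits_of_pairP X C :
  reflect (C \in X.1 \/ exists2 P, P \in X.2 & C = [set P])
          (C \in circuits_of_pair X).
Proof.
rewrite inE; apply: (iffP orP) => -[]; auto.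
  by case/imsetP=> P; right; exists P.
by case=> P PX ->; right; apply: imset_f.
Qed.

(** A host-free form of being an elementary subhypergraph, in which all the
    disjointness requirements become one. *)
Definition sachs_pair X :=
  [/\ X.1 \subset exact_cycles H, forall P, P \in X.2 -> splits_edge H P
    & {in circuits_of_pair X &, forall C D,
        C != D -> [disjoint cover C & cover D]}].

Definition sachs_order X := \sum_(C in X.1) #|C| + 2 * #|X.2|.

Lemma cover_set1 (P : {set V}) : cover [set P] = P.
Proof. by rewrite /cover big_set1. Qed.

Section SachsPair.
Variable (X : {set {set {set V}}} * {set {set V}}).
Hypothesis sX : sachs_pair X.

Lemma sachs_pair_cycle C : C \in X.1 -> 2 < #|C| /\ #|cover C| = #|C|.
Proof. by case: sX => /subsetP s1 _ _ /s1 /card_exact_cycle. Qed.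

Lemma set1_circuits_of_pair P : ([set P] \in circuits_of_pair X) = (P \in X.2).
Proof.
apply/circuits_of_pairP/idP=> [[/sachs_pair_cycle[]|[Q QX /set1_inj->]]|] //.
  by rewrite cards1.
by right; exists P.
Qed.

Lemma circuits_of_pairK : pair_of_circuits (circuits_of_pair X) = X.
Proof.
case: (X) sachs_pair_cycle set1_circuits_of_pair sX => CC EE /= sc s1 [_ sp _].
rewrite /pair_of_circuits; congr (_, _).
  apply/setP=> C; rewrite inE; apply/andP/idP => [[]|CX].
    case/circuits_of_pairP=> //= -[P PE ->].
    by rewrite cover_set1 (splits_edge_card (sp _ PE)).
  have [n3 ->] := sc C CX; split=> //.
  by apply/circuits_of_pairP; left.
by apply/setP=> P; rewrite inE s1.
Qed.

Lemma circuits_of_pair_disjoint : [disjoint X.1 & [set [set P] | P in X.2]].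
Proof.
apply/pred0Pn => -[C /andP[/= /sachs_pair_cycle[n3 _]]] /imsetP[P _ E].
by move: n3; rewrite E cards1.
Qed.

Lemma card_circuits_of_pair : #|circuits_of_pair X| = #|X.1| + #|X.2|.
Proof.
rewrite cardsU disjoint_setI0 ?circuits_of_pair_disjoint // cards0 subn0.
by rewrite card_imset // => P Q /set1_inj.
Qed.

Lemma sum_circuits_of_pair :
  \sum_(C in circuits_of_pair X) #|cover C| = sachs_order X.
Proof.
case: (sX) => _ sp _; rewrite /sachs_order.
rewrite (eq_bigl _ _ (fun C => in_setU C _ _)).
rewrite bigU ?circuits_of_pair_disjoint //=; congr (_ + _).
  by apply: eq_bigr => C /sachs_pair_cycle[].
rewrite big_imset /=; last by move=> P Q _ _ /set1_inj.
rewrite mulnC -sum_nat_const; apply: eq_bigr => P /sp.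
by rewrite cover_set1 => /splits_edge_card.
Qed.

End SachsPair.

Lemma exact_cycles_sub (H' : hypergraph T) :
  subhypergraph H' H -> exact_cycles H' \subset exact_cycles H.
Proof.
case/andP=> _ /subsetP sE; apply/subsetP=> C.
case/exact_cyclesE=> s [us n3 CE sp]; apply/exact_cyclesE; exists s; split=> //.
by move=> P /sp /exists_inP[e eH Pe]; apply/exists_inP; exists e; auto.
Qed.

(** The whole of H serves as a host. A part lying in two members of
    circuits_of_pair X is a part that violates the last clause of elementary,
    or one shared by two cycles. The bound 2 <= t holds because cycles and
    2-partitions contribute at least 2 each. *)
Lemma elementary_pairsP t X : 1 <= t <= e_index H ->
  X \in elementary_pairs H t <-> sachs_pair X /\ sachs_order X = t.
Proof.
case/andP=> t1 tk; split.
  case/imsetP=> -[[H' CC] EE] /= /and5P[_ sub /andP[cyc dis] spl].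
  case/andP=> /eqP sum one ->; split=> //; split=> //=.
  - exact: subset_trans cyc (exact_cycles_sub sub).
  - move=> P /(forall_inP spl)/exists_inP[e eH Pe].
    apply/exists_inP; exists e => //.
    by case/andP: sub => _ /subsetP; apply.
  have clash (A : V) (P : {set V}) :
      A \in cycles_cover CC -> P \in EE -> A \in P -> False.
    move=> Sc PE SP; have := forall_inP one A; rewrite inE Sc => /(_ isT).
    by rewrite ltnS leqn0 cards_eq0 => /eqP/setP/(_ P); rewrite !inE PE SP.
  move=> C D /circuits_of_pairP[/= CX|[P PX ->]]
    /circuits_of_pairP[/= DX|[Q QX ->]] ne.
  - exact: (implyP (forall_inP (forall_inP dis C CX) D DX)).
  - rewrite cover_set1; apply/pred0P=> S; apply/negP=> /andP[/= SC SQ].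
    by apply: (clash S Q) => //; apply/bigcupP; exists C.
  - rewrite cover_set1; apply/pred0P=> S; apply/negP=> /andP[/= SP SD].
    by apply: (clash S P) => //; apply/bigcupP; exists D.
  rewrite !cover_set1; apply/pred0P=> S; apply/negP=> /andP[/= SP SQ].
  have PQ : P != Q by apply: contraNneq ne => ->.
  have /(forall_inP one): S \in cycles_cover CC :|: cover EE.
    by rewrite inE; apply/orP; right; apply/bigcupP; exists P.
  apply/negP; rewrite -ltnNge (leq_trans _ (leq_addl _ _)) //.
  have <- : #|[set P; Q]| = 2 by rewrite cards2 PQ.
  apply: subset_leq_card; apply/subsetP=> A /set2P[]->; rewrite inE ?PX ?QX //.
case=> sX; case: X sX (sachs_pair_cycle sX) => CC EE [/= cyc spl dis] cc sum.
apply/imsetP; exists (H, CC, EE) => //; apply/and5P; split.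
- rewrite tk andbT -sum /sachs_order /=.
  have [C0|/set0Pn[C CX]] := eqVneq CC set0; last first.
    by rewrite (bigD1 C) //=; have [] := cc C CX; lia.
  by move: sum t1; rewrite /sachs_order /= C0 big_set0; lia.
- by apply/andP.
- rewrite cyc; apply/forall_inP=> C CX; apply/forall_inP=> D DX.
  by apply/implyP/dis; apply/circuits_of_pairP; left.
- by apply/forall_inP=> P /spl.
have /= := sum; rewrite /sachs_order /= => ->; rewrite eqxx.
apply/forall_inP=> S _.
have [/bigcupP[C CX SC]|_] := boolP (S \in cycles_cover CC).
  rewrite ltnS leqn0 cards_eq0 -subset0; apply/subsetP=> P.
  rewrite inE => /andP[PE SP].
  have ne : C != [set P].
    by apply/eqP=> E; have [] := cc C CX; rewrite E cards1.
  have := dis C [set P] _ _ ne; rewrite cover_set1 => /(_ _ _)/pred0P.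
  case/(_ _ _ S)/negbT/negP; last by rewrite /= SC.
    by apply/circuits_of_pairP; left.
  by apply/circuits_of_pairP; right; exists P.
apply/card_le1P=> P; rewrite inE => /andP[PE SP] Q.
rewrite inE [RHS]inE; apply/andP/eqP => [[QE SQ]|-> //].
apply/eqP; apply: contraT => ne; have /pred0P/(_ S) : [disjoint P & Q].
  rewrite -[P]cover_set1 -[Q]cover_set1; apply: dis.
  - by apply/circuits_of_pairP; right; exists P.
  - by apply/circuits_of_pairP; right; exists Q.
  by apply: contraNneq ne => /set1_inj ->.
by rewrite /= SP SQ.
Qed.

(** The permutations with a nonzero term in the determinant. The
    condition only depends on the circuits (adjacent_movesP). *)
Definition adjacent_moves p :=
  [forall S in moved p, splits_edge H [set S; p S]].

Lemma adjacent_movesP p :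
  reflect (forall C P, C \in circuits p -> P \in C -> splits_edge H P)
          (adjacent_moves p).
Proof.
apply: (iffP forall_inP) => [gp C P|h S mS].
  case/imsetP=> S mS -> /imsetP[S' S'S ->]; apply: gp.
  by rewrite (porbit_moved S'S).
apply: (h (circuit p S)); first exact: imset_f.
by apply/imsetP; exists S; rewrite ?porbit_id.
Qed.

Lemma short_circuit p x : x \in moved p -> p (p x) = x ->
  circuit p x = [set [set x; p x]].
Proof.
move=> mx ppx; rewrite /circuit porbit2 // imsetU !imset_set1 ppx.
by rewrite [[set p x; x]]setUC setUid.
Qed.

Lemma pair_of_circuitsK p :
  circuits_of_pair (pair_of_circuits (circuits p)) = circuits p.
Proof.
apply/setP=> C; apply/circuits_of_pairP/idP => [[/setIdP[]|[P]] //=|].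
  by rewrite inE => h ->.
move=> Cp; have /imsetP[x mx CE] := Cp; rewrite CE.
have [ppx|ppx] := eqVneq (p (p x)) x; last by left; apply: long_circuit.
right; exists [set x; p x]; last exact: short_circuit.
by rewrite inE -short_circuit // -CE.
Qed.

Lemma sachs_pair_of_circuits p :
  adjacent_moves p -> sachs_pair (pair_of_circuits (circuits p)).
Proof.
move=> /adjacent_movesP gp.
have cyc : long_circuits (circuits p) \subset exact_cycles H.
  apply/subsetP=> C /setIdP[Cp n3]; apply/exact_cyclesE.
  have /imsetP[x _ CE] := Cp.
  exists (traject p x #|porbit p x|).
  have us := uniq_traject_porbit p x.
  have sE : traject p x #|porbit p x| =i porbit p x.
    by move=> y; rewrite porbit_traject.
  have nx : {in traject p x #|porbit p x|,
      next (traject p x #|porbit p x|) =1 p}.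
    move=> y ys; apply/esym/eqP; apply: (next_cycle (e := frel p)) ys.
    have: 0 < #|porbit p x| by rewrite lt0n card_porbit_neq0.
    case E: #|porbit p x| => [|n] //= _; rewrite rcons_path fpath_traject /=.
    by rewrite -[eqbRHS](iter_porbit p) E last_traject.
  split=> //; first by rewrite size_traject -cover_circuit -CE.
    by rewrite CE; apply: circuit_edgeset.
  by move=> P; apply: gp.
have dec P : [set P] \in circuits p -> splits_edge H P.
  by move/gp; apply; rewrite set11.
split=> [//|P|C D]; first by rewrite inE; apply: dec.
by rewrite pair_of_circuitsK; apply: circuits_disjoint.
Qed.

(** A 2-partition {a, b} is run through as the sequence a, b. *)
Lemma sachs_realize X : sachs_pair X ->
  exists p, [/\ adjacent_moves p, #|moved p| = sachs_order X
              & circuits p = circuits_of_pair X].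
Proof.
move=> sX; have [cyc spl dis] := sX.
have [|p pE] := realize_circuits _ dis.
  move=> C /circuits_of_pairP[/(subsetP cyc)/exact_cyclesE|[P PX ->]].
    by case=> s [us n3 CE _]; exists s; split=> //; apply: ltnW.
  have /eqP/cards2P[a [b [ab ->]]] := splits_edge_card (spl P PX).
  exists [:: a; b]; rewrite /= inE ab; split=> //.
  apply/setP=> Q; rewrite !inE /= eqxx [b == a]eq_sym (negPf ab) eqxx.
  by rewrite [[set b; a]]setUC orbb.
exists p; split=> //; last by rewrite card_moved pE sum_circuits_of_pair.
apply/adjacent_movesP=> C P; rewrite pE.
case/circuits_of_pairP=> [/(subsetP cyc)/exact_cyclesE|[Q QX ->]].
  by case=> s [_ _ _ sp]; apply: sp.
by rewrite inE => /eqP ->; apply: spl.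
Qed.

Lemma adjacent_moves_sub p : adjacent_moves p -> moved p \subset index_set H.
Proof.
move=> /forall_inP gp; apply/subsetP=> S /gp /exists_inP[e eH Pe].
rewrite !inE; apply/orP; left; apply/exists_inP; exists e => //.
by apply/existsP; exists (p S).
Qed.

End Pairs.

Section Sum.
Local Open Scope ring_scope.

(** Permutations of the indices become permutations of all subsets of T; none
    is lost or added, because such a permutation only moves elements of
    index_set H. *)
Lemma char_poly_coef_adjacent (R : comNzRingType) (T : finType)
    (H : hypergraph T) t :
  (t <= e_index H)%N ->
  (char_poly (unified_matrix R H))`_(e_index H - t) =
    \sum_(p : {perm {set T}} | adjacent_moves H p && (#|moved p| == t))
      (-1) ^+ #|circuits p|.
Proof.
move=> tk; pose f := @enum_val _ (mem (index_set H)).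
have fI : injective f by apply: enum_val_inj.
have nloop S : splits_edge H [set S; S] = false.
  by apply/negbTE/negP=> /splits_edge_card; rewrite setUid cards1.
rewrite char_poly_coef_moved //; last first.
  by move=> i; rewrite mxE -/(splits_edge H _) nloop.
have -> : \sum_(s : 'S_(e_index H) | #|moved s| == t)
    (-1) ^+ (t + s) * \prod_(i in moved s) unified_matrix R H i (s i) =
  \sum_(s | adjacent_moves H (embed fI s) && (#|moved (embed fI s)| == t))
    (-1) ^+ #|circuits (embed fI s)|.
  rewrite big_mkcond [RHS]big_mkcond; apply: eq_bigr => s _ /=.
  rewrite card_moved_embed; case: eqP => [st|_]; last by rewrite andbF.
  rewrite andbT; case: ifPn => [/forall_inP g|/forall_inPn[S]].
    rewrite big1 ?mulr1 => [|i si].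
      rewrite -signr_odd oddD -[RHS]signr_odd -odd_circuits card_moved_embed st.
      by rewrite odd_embed oddb.
    have := g (f i); rewrite moved_embed embedE; move/(_ (imset_f _ si)).
    by rewrite mxE -/(splits_edge H _) => ->.
  rewrite moved_embed => /imsetP[i si ->]; rewrite embedE => ns.
  by rewrite (bigD1 i) //= mxE -/(splits_edge H _) (negPf ns) mul0r mulr0.
have <- : \sum_(p in embed fI @: setT | adjacent_moves H p && (#|moved p| == t))
    (-1) ^+ #|circuits p| =
  \sum_(s | adjacent_moves H (embed fI s) && (#|moved (embed fI s)| == t))
    (-1) ^+ #|circuits (embed fI s)| :> R.
  rewrite big_imset_cond; last by apply: in2W; apply: embed_inj.
  by apply: eq_bigl => s; rewrite inE.
apply: eq_bigl => p; case gp: (adjacent_moves H p); last by rewrite andbF.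
rewrite andTb; case: eqP => _; last by rewrite andbF.
rewrite andbT; apply/imsetP.
have [|s <-] := @embed_surj _ _ f fI p; last by exists s.
apply/subsetP=> S /(subsetP (adjacent_moves_sub gp)) SA; apply/codomP.
by exists (enum_rank_in SA S); rewrite /f enum_rankK_in.
Qed.

End Sum.

Local Open Scope ring_scope.

Theorem theorem6p2 (R : realFieldType) (T : finType) (H : hypergraph T)
    (simpleH : simple H) (t : nat) (t_range : (1 <= t <= e_index H)%N) :
  (char_poly (unified_matrix R H))`_(e_index H - t) =
    \sum_(X in elementary_pairs H t)
       (-1) ^+ (#|X.1| + #|X.2|) * 2 ^+ #|X.1|.
Proof.
have /andP[_ tk] := t_range; rewrite char_poly_coef_adjacent //.
rewrite (partition_big (fun p => pair_of_circuits (circuits p))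
  [in elementary_pairs H t]) /=; last first.
  move=> p /andP[gp /eqP mp]; apply/elementary_pairsP => //.
  have sp := sachs_pair_of_circuits gp; split=> //.
  by rewrite -(sum_circuits_of_pair sp) pair_of_circuitsK -card_moved.
apply: eq_bigr => X /elementary_pairsP[] // sX oX.
have [p0 [g0 m0 c0]] := sachs_realize sX.
(* The fibre over X consists of the permutations with the circuits of one of
   its members. *)
have memE p : (adjacent_moves H p && (#|moved p| == t)) &&
      (pair_of_circuits (circuits p) == X) =
    (p \in [set q | circuits q == circuits p0]).
  rewrite inE; apply/andP/eqP => [[_ /eqP dX]|pE].
    by rewrite c0 -dX pair_of_circuitsK.
  rewrite pE c0 (circuits_of_pairK sX) eqxx !card_moved pE -card_moved m0 oX.
  rewrite eqxx andbT.
  split=> //; apply/adjacent_movesP=> C P; rewrite pE; exact/adjacent_movesP.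
rewrite (eq_bigl _ _ memE).
rewrite (eq_bigr (fun _ => (-1) ^+ (#|X.1| + #|X.2|))); last first.
  by move=> p; rewrite inE => /eqP ->; rewrite c0 (card_circuits_of_pair sX).
rewrite sumr_const card_same_circuits c0.
have -> : long_circuits (circuits_of_pair X) = X.1.
  by rewrite -[in RHS](circuits_of_pairK sX).
by rewrite -[LHS]mulr_natr natrX.
Qed.
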